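(* Let $M$ be a pattern-free graph with a stable edge relation. Then $M$ is $r$-separable for every $r\in\mathbb N$; that is, for every $r$, every elementary extension $N$ of $M$ and every vertex $v\in V(N)\setminus V(M)$, there is a finite set $S\subseteq V(M)$ and an $S$-flip $N'$ of $N$ such that $\mathrm{dist}_{N'}(v,u)>r$ for all $u\in V(M)$.
   Context: Graphs are simple and possibly infinite. $M$ has a stable edge relation if there is $\ell$ such that $M$ contains no vertices $a_1,\dots,a_\ell,b_1,\dots,b_\ell$ with $a_ib_j\in E(M)\iff i\le j$. For a structure $\widehat G$ and formula $\varphi(x,y)$, $\varphi(\widehat G)$ is the graph on $V(\widehat G)$ with edges $uv$, $u\neq v$, such that $\widehat G\models\varphi(u,v)\lor\varphi(v,u)$. The $r$-subdivision of a graph replaces every edge by a path of length $r+1$. A graph $M$ is pattern-free if for every $r\ge1$, every class $\widehat{\mathscr C}$ of expansions of $M$ by unary predicates (over a fixed signature) and every quantifier-free formula $\varphi(x,y)$ there is $n$ such that for no $\widehat M\in\widehat{\mathscr C}$ does $\varphi(\widehat M)$ contain the $r$-subdivision of $K_n$ as an induced subgraph. $N$ is an elementary extension of $M$ if $V(M)\subseteq V(N)$ and for every first-order formula $\phi(\bar x)$ and tuple $\bar m$ of vertices of $M$, $M\models\phi(\bar m)\iff N\models\phi(\bar m)$. For finite $S\subseteq V(N)$, the $S$-classes partition $V(N)$: two vertices are in the same class iff they are equal or both lie outside $S$ and have the same neighbours in $S$. An $S$-flip of $N$ is obtained by choosing a set of unordered pairs $\{P,Q\}$ of $S$-classes ($P=Q$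 allowed) and complementing the adjacency between all distinct $u\in P$, $w\in Q$. *)

(* Defs.v *)
From mathcomp Require Import all_boot.
From mathcomp Require Import boolp classical_sets cardinality.

Set Implicit Arguments.
Unset Strict Implicit.
Unset Printing Implicit Defensive.

Local Open Scope classical_set_scope.

Record graph := Graph {
  vertex :> Type;
  adj : vertex -> vertex -> Prop;
  adj_sym : forall u v, adj u v -> adj v u;
  adj_irrefl : forall u, ~ adj u u
}.
Arguments adj {g} _ _.

Definition stable_edge_relation (M : graph) : Prop :=
  exists l : nat,
    ~ exists a b : 'I_l -> M, forall i j : 'I_l, adj (a i) (b j) <-> i <= j.

(** First-order logic over the signature {E} + P, where P is a type of unary
    predicate symbols. A [formula P n] has its free variables in 'I_n, so that
    sentences are meaningful in the empty structure too; the quantifiers bind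
    variable 0 and shift the others by one. *)
Inductive formula (P : Type) : nat -> Type :=
| FFalse n : formula P n
| FEq n : 'I_n -> 'I_n -> formula P n
| FAdj n : 'I_n -> 'I_n -> formula P n
| FPred n : P -> 'I_n -> formula P n
| FNot n : formula P n -> formula P n
| FAnd n : formula P n -> formula P n -> formula P n
| FOr n : formula P n -> formula P n -> formula P n
| FAll n : formula P n.+1 -> formula P n
| FEx n : formula P n.+1 -> formula P n.

Definition expansion (P : Type) (G : graph) := P -> G -> Prop.

Definition extend_val (T : Type) (n : nat) (a : T) (e : 'I_n -> T) :
    'I_n.+1 -> T :=
  fun i => if unlift ord0 i is Some j then e j else a.

Fixpoint holds (P : Type) (G : graph) (I : expansion P G) (n : nat)
    (f : formula P n) : ('I_n -> G) -> Prop :=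
  match f in formula _ n return ('I_n -> G) -> Prop with
  | FFalse _ => fun _ => False
  | FEq _ i j => fun e => e i = e j
  | FAdj _ i j => fun e => adj (e i) (e j)
  | FPred _ p i => fun e => I p (e i)
  | FNot _ f1 => fun e => ~ holds I f1 e
  | FAnd _ f1 f2 => fun e => holds I f1 e /\ holds I f2 e
  | FOr _ f1 f2 => fun e => holds I f1 e \/ holds I f2 e
  | FAll _ f1 => fun e => forall a : G, holds I f1 (extend_val a e)
  | FEx _ f1 => fun e => exists a : G, holds I f1 (extend_val a e)
  end.

Fixpoint quantifier_free (P : Type) (n : nat) (f : formula P n) : bool :=
  match f with
  | FFalse _ | FEq _ _ _ | FAdj _ _ _ | FPred _ _ _ => true
  | FNot _ f1 => quantifier_free f1
  | FAnd _ f1 f2 | FOr _ f1 f2 => quantifier_free f1 && quantifier_free f2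
  | FAll _ _ | FEx _ _ => false
  end.

Definition pair_val (T : Type) (u v : T) : 'I_2 -> T :=
  fun i => if i == ord0 then u else v.

Section Interpretation.
Variables (P : Type) (G : graph) (I : expansion P G) (phi : formula P 2).

Definition interp_adj (u v : G) : Prop :=
  u <> v /\ (holds I phi (pair_val u v) \/ holds I phi (pair_val v u)).

Lemma interp_adj_sym u v : interp_adj u v -> interp_adj v u.
Proof. by move=> [uv h]; split; [exact: nesym | case: h; [right | left]]. Qed.

Lemma interp_adj_irrefl u : ~ interp_adj u u.
Proof. by case. Qed.

Definition interp : graph := Graph interp_adj_sym interp_adj_irrefl.
End Interpretation.

(** The r-subdivision of K_n. The edges of K_n are the pairs i < j; a vertex is
    either a branch vertex or one of the r inner vertices of such an edge, and
    [subdiv_point e k], for k = 0, ..., r+1, is the k-th vertex of the path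
    that replaces e. *)
Section SubdividedClique.
Variables (r n : nat).

Definition clique_edge := {e : 'I_n * 'I_n | e.1 < e.2}.
Definition subdiv_vertex := ('I_n + clique_edge * 'I_r)%type.

Definition subdiv_point (e : clique_edge) (k : nat) : subdiv_vertex :=
  if k is k'.+1 then
    if insub k' is Some i then inr (e, i) else inl (val e).2
  else inl (val e).1.

Definition subdiv_adj (x y : subdiv_vertex) : Prop :=
  exists (e : clique_edge) (k : nat), k <= r /\
    (x = subdiv_point e k /\ y = subdiv_point e k.+1 \/
     y = subdiv_point e k /\ x = subdiv_point e k.+1).

Lemma subdiv_adj_sym x y : subdiv_adj x y -> subdiv_adj y x.
Proof.
by move=> [e [k [kr h]]]; exists e, k; split=> //; case: h; [right | left].
Qed.

Lemma subdiv_pointS e k : k <= r -> subdiv_point e k <> subdiv_point e k.+1.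
Proof.
case: k => [|k] kr /=.
  case: insubP => [//|_ [eq12]].
  by have := valP e; rewrite /= eq12 ltnn.
case: insubP => [i _ vi|]; last by rewrite kr.
case: insubP => [j _ vj [eqij]|//].
by move: vj; rewrite -eqij vi => /eqP; rewrite -[X in X == _]addn0 -addn1 eqn_add2l.
Qed.

Lemma subdiv_adj_irrefl x : ~ subdiv_adj x x.
Proof. by move=> [e [k [kr [[-> /subdiv_pointS]|[-> /subdiv_pointS]]]]]; apply. Qed.

Definition subdivided_clique : graph := Graph subdiv_adj_sym subdiv_adj_irrefl.
End SubdividedClique.

Definition contains_induced (G H : graph) : Prop :=
  exists f : H -> G,
    injective f /\ forall x y : H, adj (f x) (f y) <-> adj x y.

Definition pattern_free (M : graph) : Prop :=
  forall r : nat, 1 <= r ->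
  forall (P : Type) (C : set (expansion P M)) (phi : formula P 2),
    quantifier_free phi ->
  exists n : nat, forall I : expansion P M, C I ->
    ~ contains_induced (interp I phi) (subdivided_clique r n).

Definition graph_expansion (G : graph) : expansion void G :=
  fun p _ => match p with end.

(** The inclusion V(M) <= V(N) is an injective map iota : M -> N. *)
Definition elementary_extension (M N : graph) (iota : M -> N) : Prop :=
  injective iota /\
  forall (n : nat) (phi : formula void n) (m : 'I_n -> M),
    holds (@graph_expansion M) phi m <->
    holds (@graph_expansion N) phi (iota \o m).

Section Flip.
Variables (N : graph) (S : set N).

Definition same_class (u w : N) : Prop :=
  u = w \/
  [/\ ~ S u, ~ S w & forall s : N, S s -> (adj u s <-> adj w s)].

Definition class_of (u : N) : set N := [set w | same_class u w].

(** [F] stands for the set of unordered pairs {P, Q} with F (P, Q) or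
    F (Q, P); only its values at pairs of S-classes matter. *)
Variable F : set (set N * set N).

Definition flipped (u w : N) : Prop :=
  F (class_of u, class_of w) \/ F (class_of w, class_of u).

Definition flip_adj (u w : N) : Prop :=
  u <> w /\ (adj u w /\ ~ flipped u w \/ ~ adj u w /\ flipped u w).

Lemma flip_adj_sym u w : flip_adj u w -> flip_adj w u.
Proof.
move=> [uw h]; split; first exact: nesym.
have fS a b : flipped a b -> flipped b a by case; [right | left].
case: h => [[a f]|[a f]]; [left | right]; split.
- exact: adj_sym.
- by move/fS.
- by move/adj_sym.
- exact: fS.
Qed.

Lemma flip_adj_irrefl u : ~ flip_adj u u.
Proof. by case. Qed.

Definition flip : graph := Graph flip_adj_sym flip_adj_irrefl.
End Flip.

Inductive walk (G : graph) : nat -> G -> G -> Prop :=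
| walk0 u : walk 0 u u
| walkS k u v w : adj u v -> walk k v w -> walk k.+1 u w.

(** [None] is the infinite distance. *)
Definition dist (G : graph) (u v : G) : option nat :=
  match pselect (exists k, `[< walk k u v >]) with
  | left h => Some (ex_minn h)
  | right _ => None
  end.

Definition dist_gt (d : option nat) (r : nat) : Prop :=
  if d is Some k then r < k else True.

Lemma dist_gtP (G : graph) (u v : G) (r : nat) :
  dist_gt (dist u v) r <-> forall k, k <= r -> ~ walk k u v.
Proof.
rewrite /dist; case: pselect => [h|h] /=; last first.
  by split=> // _ k _ w; apply: h; exists k; apply/asboolP.
case: ex_minnP => m /asboolP wm mmin; split=> [rm k kr w|H].
  have /mmin mk : `[< walk k u v >] by apply/asboolP.
  by move: (leq_trans rm (leq_trans mk kr)); rewrite ltnn.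
by rewrite ltnNge; apply/negP => mr; exact: H mr wm.
Qed.

Definition separable (r : nat) (M : graph) : Prop :=
  forall (N : graph) (iota : M -> N), elementary_extension iota ->
  forall v : N, ~ range iota v ->
  exists (S : set N) (F : set (set N * set N)),
    [/\ finite_set S, S `<=` range iota &
        forall u : M, dist_gt (@dist (flip S F) v (iota u)) r].

(* Main.v *)
(** The proof works with a set [M] of vertices of [N] and three properties that
    survive flips along finitely many vertices of [M]: [N] has no infinite half
    graph, finite tuples of [N] can be copied into [M] over finite subsets of
    [M], and [M] is pattern-free. The trace of a vertex is its neighbourhood in
    [M]; by stability traces are definable over finite subsets of [M] and the
    definitions are symmetric.

    If [ball r v] misses [M] and has finitely many traces, then finitely many
    vertices of [M] define and separate these traces, and flipping their classes
    pushes [M] out of [ball r.+1 v] without touching smaller balls; this step is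
    iterated. If it had infinitely many traces, then, for minimal [r], Ramsey's
    theorem and stability would give disjoint paths from [v] whose endpoints form
    an induced matching (or its complement) with vertices of [M]; mutually
    independent copies of [v] and of these paths in [M] then form arbitrarily
    large subdivided cliques. *)

From mathcomp Require Import all_boot.
From mathcomp Require Import boolp classical_sets cardinality.
From mathcomp Require Import zify.
Require Import Defs.

Set Implicit Arguments.
Unset Strict Implicit.
Unset Printing Implicit Defensive.

Local Open Scope classical_set_scope.

(** * Infinite combinatorics *)

Definition unbounded (A : set nat) := forall n, exists2 m, n < m & A m.

Definition increasing (g : nat -> nat) := forall i j, i < j -> g i < g j.

Lemma increasingS (g : nat -> nat) : (forall i, g i < g i.+1) -> increasing g.
Proof.
move=> gS i j; elim: j => // j IH; rewrite ltnS leq_eqVlt => /orP[/eqP ->//|ij].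
exact: ltn_trans (IH ij) (gS j).
Qed.

Lemma increasing_lt (g : nat -> nat) i j : increasing g -> (g i < g j) = (i < j).
Proof.
move=> gI; case: (ltngtP i j) => [/gI //|/gI|->]; last by rewrite ltnn.
by move=> ji; apply/negbTE; rewrite -leqNgt ltnW.
Qed.

Lemma increasing_le (g : nat -> nat) i j : increasing g -> (g i <= g j) = (i <= j).
Proof. by move=> gI; rewrite leqNgt increasing_lt // -leqNgt. Qed.

Lemma increasing_comp (g h : nat -> nat) :
  increasing g -> increasing h -> increasing (g \o h).
Proof. by move=> gI hI i j /hI /gI. Qed.

Lemma unbounded_enum (A : set nat) :
  unbounded A -> exists2 g, increasing g & forall i, A (g i).
Proof.
move=> uA.
have /choice[nx nxP] n : exists m, n < m /\ A m by have [m] := uA n; exists m.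
exists (fun i => iter i.+1 nx 0); last by move=> i /=; case: (nxP (iter i nx 0)).
by apply: increasingS => i /=; case: (nxP (nx (iter i nx 0))).
Qed.

Lemma unbounded_split (A B : set nat) :
  unbounded A -> unbounded (A `&` B) \/ unbounded (A `\` B).
Proof.
move=> uA; apply: contrapT => /not_orP[/existsNP[n Hn] /existsNP[m Hm]].
have [k nk Ak] := uA (maxn n m); have [Bk|Bk] := pselect (B k).
- by apply: Hn; exists k => //; lia.
- by apply: Hm; exists k => //; lia.
Qed.

Lemma pigeonhole (K : finType) (c : nat -> K) :
  exists2 g, increasing g & exists k, forall i, c (g i) = k.
Proof.
suff [k /unbounded_enum[g gI gk]] : exists k, unbounded [set i | c i = k].
  by exists g => //; exists k.
apply: contrapT => /forallNP H.
have /choice[b bP] k : exists n, forall m, n < m -> c m <> k.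
  have /existsNP[n Hn] := H k; exists n => m nm ck; apply: Hn.
  by exists m.
by apply: (bP (c (\max_k b k).+1) (\max_k b k).+1) => //; rewrite ltnS leq_bigmax.
Qed.

(** Common core of Ramsey's theorem and of the choice of splitting vertices in [broom_extraction].
    Each stage commits to an element and a datum, then shrinks the reservoir to larger elements
    compatible with both; all later choices come from that reservoir. *)
Lemma thinning (T : Type) (Q : nat -> T -> nat -> Prop) :
  (forall A, unbounded A -> exists a t A',
     [/\ A a, A' `<=` A, unbounded A' & forall b, A' b -> Q a t b]) ->
  exists g (t : nat -> T), increasing g /\
    forall i j, i < j -> Q (g i) (t i) (g j).
Proof.
move=> H.
have /choice[F FP] (A : {A | unbounded A}) :
    exists p : nat * T * {A | unbounded A}, [/\ sval A p.1.1,
      sval p.2 `<=` sval A &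
      forall b, sval p.2 b -> p.1.1 < b /\ Q p.1.1 p.1.2 b].
  case: A => A uA /=; have [a [t [A' [Aa sA uA' QA]]]] := H A uA.
  have uA'' : unbounded (A' `&` [set b | a < b]).
    move=> n; have [m nm Am] := uA' (maxn n a).
    by exists m; [|split => //=]; lia.
  by exists (a, t, exist _ _ uA''); split => //= b [] => [/sA|/QA].
have uT : unbounded setT by move=> n; exists n.+1.
pose s i := iter i (fun A => (F A).2) (exist _ _ uT).
have sS i j : i <= j -> sval (s j) `<=` sval (s i).
  elim: j => [|j IH]; first by rewrite leqn0 => /eqP ->.
  rewrite leq_eqVlt => /orP[/eqP->//|/IH sji b].
  by have [_ sub _] := FP (s j); move/sub; exact: sji.
have key i j : i < j -> let p := F (s i) in
    p.1.1 < (F (s j)).1.1 /\ Q p.1.1 p.1.2 (F (s j)).1.1.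
  move=> ij /=; have [_ _] := FP (s i); apply.
  by have [Aj _ _] := FP (s j); exact: sS ij _ Aj.
exists (fun i => (F (s i)).1.1), (fun i => (F (s i)).1.2).
by split=> i j /key[].
Qed.

(** [thinning] gives each index a colour towards all later ones, and [pigeonhole] makes this colour
    constant. *)
Lemma ramsey (R : nat -> nat -> Prop) : exists2 g, increasing g &
  exists b : bool, forall i j, i < j -> R (g i) (g j) <-> b.
Proof.
have [A uA|g [t [gI gt]]] :=
    @thinning bool (fun a c b => R a b <-> c).
  have [a _ Aa] := uA 0; exists a.
  have [uB|uB] := unbounded_split [set b | R a b] uA; [exists true|exists false];
  (eexists; split; [exact: Aa| |exact: uB|]).
  + by move=> ? [].
  + by move=> b [].
  + by move=> ? [].
  + by move=> b [_ /= nR]; split=> //.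
have [h hI [c hc]] := pigeonhole t.
exists (g \o h); first exact: increasing_comp.
by exists c => i j ij; rewrite -(hc i); apply/gt/hI.
Qed.

Lemma ramsey_family (K : finType) (R : K -> nat -> nat -> Prop) :
  exists2 g, increasing g &
  exists b : K -> bool, forall k i j, i < j -> R k (g i) (g j) <-> b k.
Proof.
suff [g gI gP] : exists2 g, increasing g & forall k, k \in enum K ->
    exists b : bool, forall i j, i < j -> R k (g i) (g j) <-> b.
  exists g => //; have /choice[b bP] k : exists b : bool,
    forall i j, i < j -> R k (g i) (g j) <-> b by apply: gP; rewrite mem_enum.
  by exists b.
elim: (enum K) => [|k s [g gI gP]]; first by exists id.
have [h hI [b hb]] := ramsey (fun i j => R k (g i) (g j)).
exists (g \o h); first exact: increasing_comp.
move=> l; rewrite inE => /orP[/eqP->|/gP[c cP]]; first by exists b.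
by exists c => i j /hI; exact: cP.
Qed.

(** Dependent choice in which each new element may depend on the finite set of all earlier ones, as
    when vertices are copied into [M] over previous copies. *)
Lemma finite_history (T : Type) (G : set T) (Q : set T -> T -> Prop) :
  (forall A, finite_set A -> A `<=` G -> exists2 x, G x & Q A x) ->
  exists f : nat -> T, forall n, G (f n) /\ Q (f @` `I_n) (f n).
Proof.
move=> H.
have /choice[F FP] (s : {A : set T | finite_set A /\ A `<=` G}) :
    exists x, G x /\ Q (sval s) x.
  by case: s => A [fA AG] /=; have [x] := H A fA AG; exists x.
have sP (s : {A : set T | finite_set A /\ A `<=` G}) :
    finite_set (sval s `|` [set F s]) /\ (sval s `|` [set F s]) `<=` G.
  case: s (FP s) => A [fA AG] /= [GF _]; split.
    by rewrite finite_setU; split=> //; exact: finite_set1.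
  by move=> x [/AG|->].
have s0 : finite_set (@set0 T) /\ set0 `<=` G by split=> //; exact: finite_set0.
pose s n := iter n (fun s => exist _ _ (sP s)) (exist _ _ s0).
exists (fun n => F (s n)) => n.
suff -> : [set F (s i) | i in `I_n] = sval (s n) by exact: FP.
elim: n => [|n IH].
  by apply/seteqP; split=> x //= [].
rewrite /= -IH; apply/seteqP; split=> x /=.
  move=> [i /=]; rewrite ltnS leq_eqVlt => /orP[/eqP->|ilt] <-; first by right.
  by left; exists i.
by move=> [[i /= ilt <-]|->]; [exists i => //=; lia|exists n => /=].
Qed.

Lemma finite_enum (T : Type) (A : set T) :
  finite_set A -> exists n (s : 'I_n -> T), A = range s.
Proof.
move=> fA; have [s As] := @finite_seqP {classic T} A.
move: (s fA) => [l ->]; exists (size l), (fun i => tnth (in_tuple l) i).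
apply/seteqP; split=> x /=.
  by move=> /(tnthP (in_tuple l))[i ->]; exists i.
by move=> [i _ <-]; apply/(tnthP (in_tuple l)); exists i.
Qed.

(** * Traces on an existentially closed subset *)

Definition no_half_graph (N : graph) :=
  ~ exists a b : nat -> N, forall i j, adj (a i) (b j) <-> i <= j.

(** Realisation in [M] of quantifier-free types over its finite subsets: the part of elementarity
    that survives flips along finite subsets of [M]. *)
Definition existentially_closed (N : graph) (M : set N) :=
  forall (I : finType) (t : I -> N) (A : set N), finite_set A -> A `<=` M ->
  exists t' : I -> N, [/\ forall i, M (t' i),
    forall i j, t' i = t' j <-> t i = t j,
    forall i j, adj (t' i) (t' j) <-> adj (t i) (t j),
    forall i a, A a -> (t' i = a <-> t i = a) &
    forall i a, A a -> (adj (t' i) a <-> adj (t i) a)].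

Lemma adjC (N : graph) (u w : N) : adj u w <-> adj w u.
Proof. by split; exact: adj_sym. Qed.

Lemma same_class_sym (N : graph) (S : set N) u w :
  same_class S u w -> same_class S w u.
Proof.
case=> [->|[Su Sw h]]; first by left.
by right; split=> // s /h; tauto.
Qed.

Lemma same_class_trans (N : graph) (S : set N) u w x :
  same_class S u w -> same_class S w x -> same_class S u x.
Proof.
case=> [->//|[Su Sw h]] [<-|[_ Sx k]]; first by right.
by right; split=> // s Ss; rewrite h // k.
Qed.

Lemma same_class_sub (N : graph) (S S' : set N) u w :
  S `<=` S' -> same_class S' u w -> same_class S u w.
Proof.
move=> sub [->|[Su Sw h]]; first by left.
by right; split=> [/sub //|/sub //|s /sub /h].
Qed.

Lemma same_class_agree (N : graph) (S : set N) x y :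
  (forall a, S a -> (x = a <-> y = a)) ->
  (forall a, S a -> (adj x a <-> adj y a)) -> same_class S x y.
Proof.
move=> eqS adjS; have [Sx|Sx] := pselect (S x).
  by left; rewrite ((eqS x Sx).1 erefl).
by right; split=> // Sy; apply: Sx; rewrite ((eqS y Sy).2 erefl).
Qed.

Section Traces.
Variables (N : graph) (M : set N).
Hypotheses (stabN : no_half_graph N) (ecM : existentially_closed M).

Lemma vertex_copy (w : N) (A : set N) : finite_set A -> A `<=` M ->
  exists2 u, M u & forall a, A a -> (u = a <-> w = a) /\ (adj u a <-> adj w a).
Proof.
move=> fA AM; have [t [Mt _ _ eqt adjt]] := ecM (fun _ : 'I_1 => w) fA AM.
by exists (t ord0) => // a Aa; split; [exact: eqt|exact: adjt].
Qed.

Lemma class_meets (w : N) (S : set N) : finite_set S -> S `<=` M ->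
  exists2 u, M u & same_class S u w.
Proof.
move=> fS SM; have [u Mu uP] := vertex_copy w fS SM; exists u => //.
by apply: same_class_agree => a /uP[].
Qed.

(** For finite [S], the trace of [w] is then quantifier-free definable with parameters in [S]. *)
Definition determines (S : set N) (w : N) :=
  forall m m', M m -> M m' -> same_class S m m' -> adj w m -> adj w m'.

Lemma determines_sub (S S' : set N) (w : N) :
  S `<=` S' -> determines S w -> determines S' w.
Proof. by move=> sub d m m' Mm Mm' /(same_class_sub sub); exact: d. Qed.

(** Definability of types under stability. Otherwise there are $m_i, m'_i$ separated by [w] but by
    no earlier $u_j$, where $u_i$ copies [w] over all pairs up to [i]. Ramsey's theorem for the
    adjacency of $u_j$ to later $m_i$ yields a half graph in both cases. *)
Lemma trace_definable (w : N) :
  exists S, [/\ finite_set S, S `<=` M & determines S w].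
Proof.
apply: contrapT => nS.
have splitS S : finite_set S -> S `<=` M -> exists m m',
    [/\ M m, M m', same_class S m m', adj w m & ~ adj w m'].
  move=> fS SM; apply: contrapT => H; apply: nS; exists S; split=> //.
  move=> m m' Mm Mm' sc wm; apply: contrapT => wm'.
  by apply: H; exists m, m'.
pose G : set (N * N * N) := [set p | [/\ M p.1.1, M p.1.2 & M p.2]].
pose Q (A : set (N * N * N)) (p : N * N * N) :=
  [/\ (forall q, A q -> (adj q.2 p.1.1 <-> adj q.2 p.1.2)),
      adj w p.1.1, ~ adj w p.1.2 &
      [/\ adj p.2 p.1.1, ~ adj p.2 p.1.2 &
      forall q, A q -> (adj p.2 q.1.1 <-> adj w q.1.1) /\
                       (adj p.2 q.1.2 <-> adj w q.1.2)]].
have [A fA AG|f fP] := @finite_history _ G Q.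
  have [||m [m' [Mm Mm' sc wm wm']]] := splitS (snd @` A).
  - exact: finite_image.
  - by move=> _ [q /AG[_ _ Mq] <-].
  pose B := (fst \o fst) @` A `|` (snd \o fst) @` A `|` [set m; m'].
  have [||u Mu uP] := @vertex_copy w B.
  - rewrite !finite_setU.
    by do ![split]; do ?[exact: finite_image]; exact: finite_set1.
  - by move=> _ [[[q /AG[? _ _] <-]|[q /AG[_ ? _] <-]]|[->|->]].
  exists (m, m', u); first by split.
  split=> //=.
  - move=> q Aq; rewrite adjC [adj q.2 _]adjC.
    case: sc => [->//|[_ _]]; apply; exact: imageP.
  - split.
    + by apply/(uP m _).2 => //; right; left.
    + by move/(uP m' _).2; move=> h; apply: wm'; apply: h; right; right.
    + move=> q Aq; split; apply: (uP _ _).2; left; [left|right];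
      exact: imageP.
have lo j i : j < i -> adj (f j).2 (f i).1.1 <-> adj (f j).2 (f i).1.2.
  by move=> ji; have [_ [h _ _ _]] := fP i; apply: h; exists j.
have hi1 j i : i <= j -> adj (f j).2 (f i).1.1.
  have [_ [_ _ _ [h1 _ h3]]] := fP j.
  rewrite leq_eqVlt => /orP[/eqP->//|ij]; have [_ [_ wi _ _]] := fP i.
  by have [|-> _] := h3 (f i); first by exists i.
have hi2 j i : i <= j -> ~ adj (f j).2 (f i).1.2.
  have [_ [_ _ _ [_ h2 h3]]] := fP j.
  rewrite leq_eqVlt => /orP[/eqP->//|ij]; have [_ [_ _ wi _]] := fP i.
  by have [|_ ->] := h3 (f i); first by exists i.
have [g gI [b gb]] := ramsey (fun j i => adj (f j).2 (f i).1.1).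
apply: stabN; case: b gb => gb.
(* Along [g], $u_j$ is adjacent to $m'_i$ exactly when $j<i$; shifting [i] by one turns this into
   $j\le i$. *)
- exists (fun j => (f (g j)).2), (fun i => (f (g i.+1)).1.2) => j i.
  case: (leqP j i) => ji; split=> //.
    by move=> _; rewrite -lo ?gb //; exact: gI.
  by move/hi2; case; rewrite increasing_le.
- exists (fun i => (f (g i)).1.1), (fun j => (f (g j)).2) => i j; rewrite adjC.
  case: (leqP i j) => ij; split=> //.
    by move=> _; apply: hi1; rewrite increasing_le.
  by rewrite gb.
Qed.

(* If the conclusion failed, alternately copying [u] and [w] into [M] over the
   copies made so far would produce an infinite half graph. *)
Lemma trace_symmetry (S : set N) (u w m m' : N) :
  finite_set S -> S `<=` M -> determines S u -> determines S w ->
  M m -> same_class S m u -> adj w m ->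
  M m' -> same_class S m' w -> adj u m'.
Proof.
move=> fS SM du dw Mm mu wm Mm' m'w; apply: contrapT => um'.
pose G : set (N * N) :=
  [set p | [/\ M p.1, M p.2, same_class S p.1 u & same_class S p.2 w]].
pose Q (A : set (N * N)) (p : N * N) :=
  [/\ forall q, A q -> ~ adj p.1 q.2, adj p.2 p.1 &
      forall q, A q -> adj p.2 q.1].
have adjw x : M x -> same_class S x u -> adj w x.
  move=> Mx xu; apply: (dw m) => //.
  exact: same_class_trans mu (same_class_sym xu).
have nadju x : M x -> same_class S x w -> ~ adj u x.
  move=> Mx xw ux; apply/um'/(du x) => //.
  exact: same_class_trans xw (same_class_sym m'w).
have [A fA AG|f fP] := @finite_history _ G Q.
  have [||a Ma aP] := @vertex_copy u (S `|` snd @` A).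
  - by rewrite finite_setU; split=> //; exact: finite_image.
  - by move=> x [/SM//|[q /AG[_ Mq _ _] <-]].
  have [||b Mb bP] := @vertex_copy w (S `|` fst @` A `|` [set a]).
  - rewrite !finite_setU; split; last exact: finite_set1.
    by split=> //; exact: finite_image.
  - by move=> x [[/SM//|[q /AG[Mq _ _ _] <-]]|->].
  have au : same_class S a u.
    by apply: same_class_agree => x Sx; have [] := aP x (or_introl Sx).
  have bw : same_class S b w.
    by apply: same_class_agree => x Sx; have [] := bP x (or_introl (or_introl Sx)).
  exists (a, b) => //; split=> /=.
  - move=> q Aq; have [_ Mq _ qw] := AG q Aq.
    have [_ ->] := aP q.2 (or_intror (imageP _ Aq)); exact: nadju.
  - have [_ ->] := bP a (or_intror erefl); exact: adjw.
  - move=> q Aq; have [Mq _ qu _] := AG q Aq.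
    have [_ ->] := bP q.1 (or_introl (or_intror (imageP _ Aq))); exact: adjw.
apply: stabN; exists (fun i => (f i).1), (fun i => (f i).2) => i j.
case: (leqP i j) => [ij|ji]; split=> //.
- move: ij; rewrite leq_eqVlt adjC => /orP[/eqP->|ij] _.
    by have [_ []] := fP j.
  by have [_ [_ _ h]] := fP j; apply: h; exists i.
- by have [_ [h _ _]] := fP i; move=> /h[]; exists j.
Qed.

End Traces.

(** * Flips *)

Definition symmetric_rel (T : Type) (X : T -> T -> Prop) :=
  forall u w, X u w -> X w u.

Section RelationFlip.
Variables (N : graph) (X : N -> N -> Prop) (symX : symmetric_rel X).

(** A flip is given by the relation to be complemented instead of a set of pairs of classes, so that
    composing flips amounts to a symmetric difference. *)
Definition rel_flip_adj (u w : N) : Prop :=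
  u <> w /\ (adj u w /\ ~ X u w \/ ~ adj u w /\ X u w).

Lemma rel_flip_adj_sym u w : rel_flip_adj u w -> rel_flip_adj w u.
Proof.
have XC a b : X a b <-> X b a by split; exact: symX.
by move=> [uw]; rewrite adjC XC; split=> //; exact: nesym.
Qed.

Lemma rel_flip_adj_irrefl u : ~ rel_flip_adj u u.
Proof. by case. Qed.

Definition rel_flip : graph := Graph rel_flip_adj_sym rel_flip_adj_irrefl.

End RelationFlip.

Definition respects_classes (N : graph) (S : set N) (X : N -> N -> Prop) :=
  forall u u' w, same_class S u u' -> X u w -> X u' w.

Lemma respects_classes2 (N : graph) (S : set N) (X : N -> N -> Prop) u u' w w' :
  symmetric_rel X -> respects_classes S X ->
  same_class S u u' -> same_class S w w' -> X u w <-> X u' w'.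
Proof.
move=> symX rX uu' ww'; split.
  by move=> /(rX _ _ _ uu') /symX /(rX _ _ _ ww') /symX.
move=> /(rX _ _ _ (same_class_sym uu')) /symX.
by move=> /(rX _ _ _ (same_class_sym ww')) /symX.
Qed.

Lemma class_coloring (N : graph) (S : set N) : finite_set S ->
  exists (K : finType) (c : N -> K), forall u w, c u = c w -> same_class S u w.
Proof.
move=> /finite_enum[n [s ->]].
exists {ffun 'I_n -> bool * bool},
  (fun u => [ffun i => (`[< u = s i >], `[< adj u (s i) >])]) => u w eqc.
by apply: same_class_agree => _ [i _ <-]; move/ffunP: eqc => /(_ i);
  rewrite !ffunE => -[e1 e2]; apply: asbool_eq_equiv.
Qed.

(** Factoring the flip relation through finitely many colours opens it to the pigeonhole principle
    and lets colour patterns absorb it. *)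
Lemma respects_colors (N : graph) (S : set N) (X : N -> N -> Prop) :
  finite_set S -> symmetric_rel X -> respects_classes S X ->
  exists (K : finType) (c : N -> K) (F : K -> K -> bool),
    forall u w, X u w <-> F (c u) (c w).
Proof.
move=> /class_coloring[K [c cP]] symX rX.
exists K, c, (fun k l => `[< exists u w, [/\ c u = k, c w = l & X u w] >]).
move=> u w; split=> [Xuw|/asboolP[u' [w' [/cP cu /cP cw]]]].
  by apply/asboolP; exists u, w.
by rewrite (respects_classes2 symX rX cu cw).
Qed.

Definition color_adj (N : graph) (C : Type) (g : C -> C -> bool -> bool)
    (T : Type) (chi : T -> C) (f : T -> N) (x y : T) : Prop :=
  x <> y /\ (g (chi x) (chi y) `[< adj (f x) (f y) >] \/
             g (chi y) (chi x) `[< adj (f x) (f y) >]).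

(** Pattern-freeness of the subgraph induced on [M]: a quantifier-free formula
    is a Boolean function of the colours of its two arguments and of their
    adjacency, and only the colours of the pattern itself matter. *)
Definition pattern_free_on (N : graph) (M : set N) :=
  forall r, 1 <= r -> forall (C : finType) (g : C -> C -> bool -> bool),
  exists n, forall (chi : subdiv_vertex r n -> C) (f : subdiv_vertex r n -> N),
    (forall x, M (f x)) -> injective f ->
    ~ forall x y, color_adj g chi f x y <-> subdiv_adj x y.

Section FlipPreserves.
Variables (N : graph) (M S : set N) (X : N -> N -> Prop).
Hypotheses (symX : symmetric_rel X) (rX : respects_classes S X).
Hypotheses (fS : finite_set S) (SM : S `<=` M).

(** By pigeonhole [X] may be assumed constant between the two sides. If it is false, the half graph
    is already in [N]; if true, [N] contains the bipartite complement, which is a half graph after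
    exchanging sides and shifting. *)
Lemma rel_flip_no_half_graph :
  no_half_graph N -> no_half_graph (rel_flip symX).
Proof.
move=> stabN; suff: ~ exists a b : nat -> N,
  forall i j, rel_flip_adj X (a i) (b j) <-> i <= j by [].
move=> [a [b ab]]; apply: stabN.
have [K [c [F cF]]] := respects_colors fS symX rX.
have [g gI [[k l] gkl]] := pigeonhole (fun i => (c (a i), c (b i))).
have XF i j : X (a (g i)) (b (g j)) <-> F k l.
  by rewrite cF; have [-> _] := gkl i; have [_ ->] := gkl j.
have ab' i j : rel_flip_adj X (a (g i)) (b (g j)) <-> i <= j.
  by rewrite ab increasing_le.
case: (F k l) XF => XF.
- have lo i j : i <= j -> a (g i) <> b (g j) /\ ~ adj (a (g i)) (b (g j)).
    by have := (XF i j).2 isT; move=> Xij /ab'[ne]; tauto.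
  have hi i j : j < i -> a (g i) <> b (g j) -> adj (a (g i)) (b (g j)).
    move=> ji ne; apply: contrapT => nadj.
    have : i <= j by apply/ab'; split=> //; right; split=> //; exact/XF.
    by lia.
  (* Flips have no loops, so a non-edge below the diagonal may also come from an equality of the two
     vertices. If this happened homogeneously, two equalities would identify $a_1$ with $b_1$, which
     are adjacent in the flip. *)
  have [h hI [[] hb]] := ramsey (fun j i => a (g i) = b (g j)).
    have e20 := (hb 0 2 isT).2 isT; have e21 := (hb 1 2 isT).2 isT.
    have e10 := (hb 0 1 isT).2 isT.
    have [] // := lo (h 1) (h 1) (leqnn _).
    by rewrite -e21 e20.
  exists (fun j => b (g (h j))), (fun i => a (g (h i.+1))) => j i; rewrite adjC.
  case: (leqP j i) => ji; split=> //.
    move=> _; apply: hi; first exact: hI.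
    by move/hb => /(_ ji).
  by move=> adjij; have [] := lo (h i.+1) (h j); rewrite ?increasing_le.
- exists (a \o g), (b \o g) => i j /=; rewrite -ab' /rel_flip_adj XF.
  split=> [aij|[_ [[]|[]]]] //; split; last by left; split.
  by move=> e; move: aij; rewrite e; exact: adj_irrefl.
Qed.

(** Copying over [S] as well keeps each copy in the [S]-class of its original, so [X] treats both
    alike. *)
Lemma rel_flip_existentially_closed :
  existentially_closed M -> @existentially_closed (rel_flip symX) M.
Proof.
move=> ecM I t A fA AM.
have [||t' [Mt' eqt adjt eqA adjA]] := ecM I t (A `|` S).
- by rewrite finite_setU.
- by move=> x [/AM|/SM].
have cl i : same_class S (t' i) (t i).
  by apply: same_class_agree => a Sa; [apply: eqA|apply: adjA]; right.
have XX i u w : same_class S u w -> X (t' i) u <-> X (t i) w.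
  exact: respects_classes2.
exists t'; split=> //.
- move=> i j; rewrite /= /rel_flip_adj adjt eqt.
  by rewrite (XX i _ (t j)) //; exact: cl.
- by move=> i a Aa; apply: eqA; left.
- move=> i a Aa /=; rewrite /rel_flip_adj.
  rewrite adjA ?eqA; [|by left|by left].
  by rewrite (XX i _ a) //; left.
Qed.

(** The flip is undone inside the pattern: colours also record the class colour, and the Boolean
    function corrects the adjacency bit by [F]. *)
Lemma rel_flip_pattern_free_on :
  pattern_free_on M -> @pattern_free_on (rel_flip symX) M.
Proof.
move=> pfM r r1 C g; have [K [c [F cF]]] := respects_colors fS symX rX.
have [n nP] := pfM r r1 (C * K)%type (fun p q b => g p.1 q.1 (b (+) F p.2 q.2)).
exists n => chi f Mf injf H; apply: (nP (fun x => (chi x, c (f x))) f Mf injf).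
move=> x y; rewrite -H /color_adj /=.
suff E : x <> y -> `[< @adj N (f x) (f y) >] (+) F (c (f x)) (c (f y)) =
          `[< rel_flip_adj X (f x) (f y) >] /\
         `[< @adj N (f x) (f y) >] (+) F (c (f y)) (c (f x)) =
          `[< rel_flip_adj X (f x) (f y) >].
  by split=> -[xy]; have [-> ->] := E xy.
move=> xy; have -> : F (c (f y)) (c (f x)) = F (c (f x)) (c (f y)).
  by apply/idP/idP => /cF /symX /cF.
suff -> : `[< @adj N (f x) (f y) >] (+) F (c (f x)) (c (f y)) =
          `[< rel_flip_adj X (f x) (f y) >] by [].
have fxy : f x <> f y by move/injf.
apply/esym; case: (F _ _) (cF (f x) (f y)) => -[XF FX].
- have Xxy := FX isT; case: (asboolP (@adj N _ _)) => axy /=.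
    by apply: asboolF => -[_]; tauto.
  by apply: asboolT; split=> //; tauto.
- have nXxy : ~ X (f x) (f y) by move/XF.
  case: (asboolP (@adj N _ _)) => axy /=; last by apply: asboolF => -[_]; tauto.
  by apply: asboolT; split=> //; tauto.
Qed.

End FlipPreserves.

(** * Balls *)

Fixpoint ball (N : graph) (r : nat) (v : N) : set N :=
  if r is r'.+1 then ball r' v `|` [set u | exists2 w, ball r' v w & adj w u]
  else [set v].

Lemma ball_self (N : graph) r (v : N) : ball r v v.
Proof. by elim: r => //= r; left. Qed.

Lemma ball_le (N : graph) r s (v : N) : r <= s -> ball r v `<=` ball s v.
Proof.
elim: s => [|s IH]; first by rewrite leqn0 => /eqP->.
by rewrite leq_eqVlt => /orP[/eqP->//|/IH rs u /rs]; left.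
Qed.

Lemma ball_trans (N : graph) r s (u w x : N) :
  ball r u w -> ball s w x -> ball (r + s) u x.
Proof.
move=> uw; elim: s x => [|s IH] x /=; first by move=> ->; rewrite addn0.
rewrite addnS => -[/IH|[y /IH uy yx]]; first by left.
by right; exists y.
Qed.

Lemma ball_adj (N : graph) (u w : N) : adj u w -> ball 1 u w.
Proof. by right; exists u. Qed.

Lemma ball_front (N : graph) r (v u : N) : ball r.+1 v u ->
  ball r v u \/ exists2 x, adj v x & ball r x u.
Proof.
elim: r u => [|r IH] u /=.
  by move=> [->|[_ -> vu]]; [left|right; exists u].
move=> [/IH[|[x vx xu]]|[w /IH[vw|[x vx xw]] wu]].
- by left; left.
- by right; exists x => //; left.
- by left; right; exists w.
- by right; exists x => //; right; exists w.
Qed.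

Lemma ball_homo (G H : graph) (phi : G -> H) k (u w : G) :
  (forall x y, adj x y -> adj (phi x) (phi y)) ->
  ball k u w -> ball k (phi u) (phi w).
Proof.
move=> homo; elim: k w => [|k IH] w; first by move=> ->.
by move=> [/IH|[x /IH ux /homo xw]]; [left|right; exists (phi x)].
Qed.

Lemma ball_walk (N : graph) k (u w : N) : walk k u w -> ball k u w.
Proof.
elim=> [//|{}k x y z xy _ yz]; rewrite -add1n.
exact: ball_trans (ball_adj xy) yz.
Qed.

Lemma ball_path (N : graph) (p : nat -> N) i k :
  (forall j, j < k -> adj (p (i + j)) (p (i + j).+1)) ->
  ball k (p i) (p (i + k)).
Proof.
elim: k => [|k IH] pP; first by rewrite addn0.
right; exists (p (i + k)); last by rewrite addnS; exact: pP.
by apply: IH => j jk; apply: pP; lia.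
Qed.

(** Balls allow stopping early; minimality of the distance forces a path with exactly [r] steps. *)
Lemma geodesic (N : graph) r (v u : N) :
  ball r v u -> (forall s, s < r -> ~ ball s v u) ->
  exists p : nat -> N,
    [/\ p 0 = v, p r = u & forall k, k < r -> adj (p k) (p k.+1)].
Proof.
elim: r u => [|r IH] u; first by move=> -> _; exists (fun=> v).
move=> [ru|[w vw wu]] far; first by have := far r (ltnSn r) ru.
have [//|s sr vs|p [p0 pr pP]] := IH w.
  by apply: (far s.+1); [|right; exists w].
exists (fun k => if k <= r then p k else u); split=> //.
- by rewrite ltnn.
- move=> k /= kr1; case: (ltngtP k r) => [kr|rk|->]; last by rewrite pr.
    exact: pP.
  by exfalso; lia.
Qed.

(** * Separation by one more step *)

Section Separation.
Variables (N : graph) (M : set N).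

Definition same_trace (w w' : N) := forall m, M m -> (adj w m <-> adj w' m).

Definition finitely_many_traces (B : set N) := exists R : set N,
  finite_set R /\ forall w, B w -> exists2 w', R w' & same_trace w w'.

Hypotheses (stabN : no_half_graph N) (ecM : existentially_closed M).

Lemma inner_trace r (v p m : N) : (forall u, M u -> ~ ball r.+1 v u) ->
  ball r v p -> M m -> ~ adj p m.
Proof. by move=> far vp Mm pm; apply: (far m) => //; right; exists p. Qed.

(** [S] collects the parameters defining the traces of the finitely many representatives and, for
    each two representatives with different traces, one vertex of [M] telling them apart. *)
Lemma separating_set (B : set N) : finitely_many_traces B ->
  exists S, [/\ finite_set S, S `<=` M, forall p, B p -> determines M S p &
    forall p p', B p -> B p' -> same_class S p p' -> same_trace p p'].
Proof.
move=> [R [fR RP]].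
have /choice[D DP] w := trace_definable stabN ecM w.
have /choice[Z ZP] (q : N * N) : exists Z : set N, [/\ finite_set Z, Z `<=` M &
    (forall m, Z m -> (adj q.1 m <-> adj q.2 m)) -> same_trace q.1 q.2].
  have [e|ne] := pselect (same_trace q.1 q.2).
    by exists set0; split=> //; exact: finite_set0.
  have /existsNP[m /not_implyP[Mm nm]] := ne.
  exists [set m]; split; [exact: finite_set1|by move=> _ ->|].
  by move=> /(_ m erefl).
exists (\bigcup_(w in R) D w `|` \bigcup_(q in R `*` R) Z q); split.
- rewrite finite_setU; split; apply: bigcup_finite => //.
  + by move=> w _; have [] := DP w.
  + exact: finite_setX.
  + by move=> q _; have [] := ZP q.
- move=> x [[w _ Dx]|[q _ Zx]].
  + by have [_ sub _] := DP w; exact: sub.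
  + by have [_ sub _] := ZP q; exact: sub.
- move=> p /RP[w Rw pw].
  have [_ _ dw] := DP w.
  have d' : determines M (\bigcup_(w in R) D w `|` \bigcup_(q in R `*` R) Z q) w.
    by apply: determines_sub dw => x Dx; left; exists w.
  move=> m m' Mm Mm' mm'; rewrite pw // pw //; exact: d'.
- move=> p p' /RP[w Rw pw] /RP[w' Rw' pw'] [->//|[_ _ pp'] m Mm].
  rewrite pw // pw' //; have [_ ZM ZE] := ZP (w, w'); apply: ZE => // a Za.
  have Ma := ZM _ Za; rewrite -pw // -pw' //; apply: pp'.
  by right; exists (w, w').
Qed.

(* The flip exchanges the classes of [ball r v] with the classes of [M] in
   their traces; vertices of smaller balls have empty traces, and by symmetry
   of traces none of their edges is touched. *)
Lemma separation_step r (v : N) : (forall u, M u -> ~ ball r v u) ->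
  finitely_many_traces (ball r v) ->
  exists (S : set N) (X : N -> N -> Prop) (symX : symmetric_rel X),
    [/\ finite_set S, S `<=` M, respects_classes S X &
        forall u, M u -> ~ @ball (rel_flip symX) r.+1 v u].
Proof.
move=> far /separating_set[S [fS SM dS tS]].
pose D u w := exists p m,
  [/\ ball r v p, M m, same_class S u p, same_class S w m & adj p m].
pose X u w := D u w \/ D w u.
have symX : symmetric_rel X by move=> u w [|]; [right|left].
have Xball p m : ball r v p -> M m -> X p m -> adj p m.
  move=> vp Mm [[p' [m' [vp' Mm' pp' mm' pm']]]|[p' [m' [vp' Mm' mp' pm' pm]]]].
    apply: (dS p vp m' m) => //; first exact: same_class_sym.
    exact/(tS p p').
  apply: (trace_symmetry stabN ecM fS SM (dS _ vp) (dS _ vp') Mm' _ pm Mm mp').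
  exact: same_class_sym.
have adj_inner k p q : k < r -> ball k v p -> X p q -> False.
  move=> kr vp.
  have vp' : ball r v p by apply: ball_le vp; exact: ltnW.
  have empty m : M m -> ~ adj p m.
    move=> Mm pm; apply: (far m Mm).
    by apply: (@ball_le _ k.+1 r) => //; right; exists p.
  move=> [[p' [m [vq Mm pp' qm pm]]]|[p' [m [vq Mm qp' pm p'm]]]].
    by apply: (empty m) => //; apply/(tS p p').
  (* [p'] itself need not lie in [M], so the symmetry of traces is applied to a vertex of [M] in its
     class. *)
  have [m' Mm' m'p'] := class_meets ecM p' fS SM.
  apply: (empty m' Mm').
  apply: (trace_symmetry stabN ecM fS SM (dS _ vp') (dS _ vq) Mm _ p'm Mm' m'p').
  exact: same_class_sym.
have ballsub k : k <= r -> @ball (rel_flip symX) k v `<=` ball k v.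
  elim: k => [_ u //|k IH kr u [/(IH (ltnW kr))|[w /(IH (ltnW kr)) vw wu]]].
    by left.
  right; exists w => //; case: wu => _ [[]//|[_ /(adj_inner k)]].
  by move=> /(_ kr vw).
exists S, X, symX; split=> //.
- move=> u u' w uu' [[p [m [vp Mm up wm pm]]]|[p [m [vp Mm wp um pm]]]].
  + left; exists p, m; split=> //.
    exact: same_class_trans (same_class_sym uu') up.
  + right; exists p, m; split=> //.
    exact: same_class_trans (same_class_sym uu') um.
- move=> u Mu [/(ballsub r (leqnn r))|[w /(ballsub r (leqnn r)) vw wu]].
    exact: far.
  case: wu => _ [[wu []]|[nwu Xwu]]; last exact/nwu/Xball.
  by left; exists w, u; split=> //; left.
Qed.

End Separation.

(** * Finiteness of the number of traces *)

Section Coordinates.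
Variables (r n : nat).

Local Notation vtx := (subdiv_vertex r.*2.+3 n).

(* The [2r+3]-subdivision of the clique is viewed as layered by the distance
   [depth] to the branch vertices; the middle vertices form the last layer, and
   [side x] is the branch vertex closest to [x] (junk on the last layer). *)
Definition depth (x : vtx) : nat :=
  match x with
  | inl _ => 0
  | inr (e, k) => if k <= r.+1 then k.+1 else r.*2.+3 - k
  end.

Definition side (x : vtx) : 'I_n :=
  match x with
  | inl a => a
  | inr (e, k) => if k <= r.+1 then (val e).1 else (val e).2
  end.

Definition edge_of (x : vtx) : option (clique_edge n) :=
  if x is inr (e, _) then Some e else None.

Lemma depth_le x : depth x <= r.+2.
Proof. by case: x => [//|[e k]] /=; case: ifP; lia. Qed.

(** Depth and edge fix a vertex up to reversal of the path, and the side resolves this; on the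
    middle layer there is nothing to resolve, and a branch vertex is given by its side alone. *)
Lemma coordinates_inj x y : depth x = depth y ->
  side x = side y \/ depth x = r.+2 -> edge_of x = edge_of y \/ depth x = 0 ->
  x = y.
Proof.
case: x y => [a|[e k]] [b|[e' k']] /=.
- by move=> _ [->|].
- by case: ifP => _; have := ltn_ord k'; lia.
- by case: ifP => _; have := ltn_ord k; lia.
move=> dE sE eE; have ee' : e = e'.
  by case: eE => [[]//|]; case: ifP => _; have := ltn_ord k; lia.
rewrite -{}ee' in sE *; suff -> : k = k' by [].
apply: val_inj => /=; have ne : (val e).1 <> (val e).2.
  by move=> e12; have := valP e; rewrite /= e12 ltnn.
have := ltn_ord k; have := ltn_ord k'; move: dE sE.
case: (leqP k r.+1) => kr; case: (leqP k' r.+1) => kr' dE sE; try lia.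
- by case: sE => [/ne//|dk]; lia.
- by case: sE => [/esym/ne//|dk]; lia.
Qed.

Lemma coordinates_point (e : clique_edge n) k : k <= r.*2.+4 ->
  let x := subdiv_point r.*2.+3 e k in
  [/\ depth x = if k <= r.+2 then k else r.*2.+4 - k,
      side x = (if k <= r.+2 then (val e).1 else (val e).2) &
      0 < k < r.*2.+4 -> edge_of x = Some e].
Proof.
case: k => [//|k kr] /=; case: insubP => [i _ ik|] /=.
  by rewrite ik !ltnS; split=> //; case: ifP; lia.
rewrite -leqNgt => rk; have -> : k = r.*2.+3 by lia.
by split=> //; do ?[case: ifP => //]; lia.
Qed.

(** Adjacency of the subdivided clique, oriented away from the branch vertices. A branch vertex lies
    on several edges and a middle vertex has a neighbour on each side, hence the two exceptions. *)
Definition below (x y : vtx) :=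
  [/\ (depth x).+1 = depth y, edge_of x = edge_of y \/ depth x = 0 &
      side x = side y \/ depth y = r.+2].

Lemma below_point e k : k <= r.+1 ->
  below (subdiv_point _ e k) (subdiv_point _ e k.+1).
Proof.
move=> kr; have [|d1 s1 e1] := @coordinates_point e k; first lia.
have [|d2 s2 e2] := @coordinates_point e k.+1; first lia.
split.
- by rewrite d1 d2; do ![case: ifP]; lia.
- case: (posnP k) => k0; [right|left].
    by rewrite d1; case: ifP; lia.
  by rewrite e1 ?e2 //; lia.
- by left; rewrite s1 s2; do ![case: ifP] => //; lia.
Qed.

Lemma above_point e k : r.+2 <= k <= r.*2.+3 ->
  below (subdiv_point _ e k.+1) (subdiv_point _ e k).
Proof.
move=> /andP[rk kr]; have [|d1 s1 e1] := @coordinates_point e k; first lia.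
have [|d2 s2 e2] := @coordinates_point e k.+1; first lia.
split.
- by rewrite d1 d2; do ![case: ifP]; lia.
- case: (eqVneq k r.*2.+3) => k0; [right|left].
    by rewrite d2; case: ifP; lia.
  by rewrite e1 ?e2 //; lia.
- case: (eqVneq k r.+2) => k0; [right|left].
    by rewrite d1; case: ifP; lia.
  by rewrite s1 s2; do ![case: ifP] => //; lia.
Qed.

Lemma below_inj x x' y : depth y < r.+2 -> below x y -> below x' y -> x = x'.
Proof.
move=> yr [d e s] [d' e' s']; apply: coordinates_inj; first lia.
  by left; case: s => [->|]; [case: s' => [<-//|]|]; lia.
case: e => [->|]; last by right.
by case: e' => [<-|]; [left|right; lia].
Qed.

Lemma below_subdiv_adj x y : below x y -> subdiv_adj x y.
Proof.
case: y => [b [//]|[e k] xy].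
have yE : inr (e, k) = subdiv_point r.*2.+3 e k.+1 by rewrite /= valK.
have kr := ltn_ord k; have [yr|yr] := ltnP (depth (inr (e, k))) r.+2.
  case: (leqP k r.+1) => rk.
    exists e, k; split; first lia.
    left; split=> //; apply: (below_inj yr xy); rewrite yE; exact: below_point.
  exists e, k.+1; split; first lia.
  right; split=> //; apply: (below_inj yr xy); rewrite yE; apply: above_point.
  by lia.
(* Now [y] is the middle vertex, at position [r.+2] of its path; its neighbours at positions [r.+1]
   and [r.+3] are told apart by their side. *)
have kE : k = r.+1 :> nat.
  by move: yr => /=; case: ifP; lia.
have [dx ex _] := xy.
have {}dx : depth x = r.+1 by move: dx => /=; rewrite kE leqnn; lia.
have {}ex : edge_of x = Some e by case: ex => [//|]; lia.
have [|d1 s1 e1] := @coordinates_point e r.+1; first lia.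
have [|d2 s2 e2] := @coordinates_point e r.+3; first lia.
have : side x = (val e).1 \/ side x = (val e).2.
  case: x ex {xy dx} => [//|[e' k'] /= [->]]; case: ifP => _; [by left|by right].
case=> sx.
- exists e, r.+1; split; first lia.
  left; split; last by rewrite yE kE.
  apply: coordinates_inj.
  + by rewrite d1 dx; case: ifP; lia.
  + by left; rewrite s1 sx; case: ifP => //; lia.
  + by left; rewrite ex e1 //; lia.
- exists e, r.+2; split; first lia.
  right; split; first by rewrite yE kE.
  apply: coordinates_inj.
  + by rewrite d2 dx; case: ifP; lia.
  + by left; rewrite s2 sx; case: ifP => //; lia.
  + by left; rewrite ex e2 //; lia.
Qed.

Lemma subdiv_adj_below x y : subdiv_adj x y <-> below x y \/ below y x.
Proof.
split=> [[e [k [kr]]]|[|]]; last 2 first.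
- exact: below_subdiv_adj.
- by move/below_subdiv_adj; exact: subdiv_adj_sym.
case: (leqP k r.+1) => rk.
  by have := below_point e rk; move=> b [[-> ->]|[-> ->]]; [left|right].
have b : below (subdiv_point _ e k.+1) (subdiv_point _ e k).
  by apply: above_point; lia.
by move=> [[-> ->]|[-> ->]]; [right|left].
Qed.

End Coordinates.

(** * From infinitely many traces to subdivided cliques *)

Section FiniteTraces.
Variables (N : graph) (M : set N).
Hypotheses (stabN : no_half_graph N) (ecM : existentially_closed M).
Hypothesis (pfM : pattern_free_on M).

(** The copies are chosen one after another over [B], over parameters defining the traces of all
    [t i], and over the earlier copies. A later copy then sees an earlier one exactly as its
    original does. *)
Lemma independent_copies (I : finType) (t : I -> N) (B : set N) :
  finite_set B -> B `<=` M -> (forall i, ~ M (t i)) ->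
  exists c : nat -> I -> N, [/\ forall a i, M (c a i),
    forall a i j, c a i = c a j <-> t i = t j,
    forall a i j, adj (c a i) (c a j) <-> adj (t i) (t j),
    forall a i b, B b -> c a i <> b /\ (adj (c a i) b <-> adj (t i) b) &
    forall a a' i j, a <> a' -> c a i <> c a' j /\
      ((forall m, M m -> ~ adj (t i) m) -> ~ adj (c a i) (c a' j))].
Proof.
move=> fB BM Mt.
have /choice[D DP] i := trace_definable stabN ecM (t i).
pose S := \bigcup_(i in [set: I]) D i.
have fS : finite_set S.
  by apply: bigcup_finite; [exact: finite_finset|move=> i _; have [] := DP i].
have SM : S `<=` M by move=> x [i _]; have [_ sub _] := DP i; exact: sub.
have dS i : determines M S (t i).
  by have [_ _] := DP i; apply: determines_sub => x Dx; exists i.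
pose G : set (I -> N) := [set x | [/\ forall i, M (x i),
  forall i, same_class S (x i) (t i),
  forall i j, x i = x j <-> t i = t j,
  forall i j, adj (x i) (x j) <-> adj (t i) (t j) &
  forall i b, B b -> x i <> b /\ (adj (x i) b <-> adj (t i) b)]].
pose Q (A : set (I -> N)) (x : I -> N) := forall y i j, A y ->
  x i <> y j /\ (adj (x i) (y j) <-> adj (t i) (y j)).
have [A fA AG|c cP] := @finite_history _ G Q.
  pose U := \bigcup_(y in A) range y.
  have MU : U `<=` M by move=> _ [y /AG[My _ _ _ _] [i _ <-]].
  have [||x [Mx eqx adjx eqA adjA]] := ecM t (A := B `|` S `|` U).
  - rewrite !finite_setU; do ![split=> //]; apply: bigcup_finite => // y _.
    by apply: finite_image; exact: finite_finset.
  - by move=> y [[/BM|/SM]|/MU].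
  have neA i a : M a -> (B `|` S `|` U) a -> x i <> a.
    by move=> Ma /(eqA i) e /e ta; apply: (Mt i); rewrite ta.
  exists x; first split=> //.
  - by move=> i; apply: same_class_agree => a Sa; [apply: eqA|apply: adjA];
      left; right.
  - move=> i b Bb; split; last by apply: adjA; left; left.
    by apply: neA; [exact: BM|left; left].
  - move=> y i j Ay; have Uy : U (y j) by exists y.
    split; last by apply: adjA; right.
    by apply: neA; [exact: MU|right].
exists c; split.
- by move=> a; have [[]] := cP a.
- by move=> a; have [[]] := cP a.
- by move=> a; have [[]] := cP a.
- by move=> a; have [[]] := cP a.
have lt a a' i j : a' < a ->
    c a i <> c a' j /\ (adj (c a i) (c a' j) <-> adj (t i) (c a' j)).
  by move=> aa'; have [_] := cP a; apply; exists a'.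
move=> a a' i j aa'; have [{}aa'|{}aa'|//] := ltngtP a a'.
- have [ne adjE] := lt a' a j i aa'; split; first exact: nesym.
  move=> empty /adj_sym /adjE tji.
  (* Here the copy of [t i] is the earlier one, so the edge comes from [t j]; symmetry of traces
     carries it over to [t i]. *)
  have [m Mm mc] := class_meets ecM (t j) fS SM.
  apply: (empty m Mm).
  have [[Mc scc _ _ _] _] := cP a.
  exact: (trace_symmetry stabN ecM fS SM (dS i) (dS j) (Mc i) (scc i) tji Mm mc).
- have [ne adjE] := lt a a' i j aa'; split=> // empty /adjE.
  by apply: empty; have [[]] := cP a'.
Qed.

(** [P i 0 = v] for all [i] (take [k = l = 0] in the first clause); for
    [eps = false] the last clause is an induced matching, for [eps = true] its
    bipartite complement. *)
Definition broom r (v : N) (P : nat -> nat -> N) (m : nat -> N) (eps : bool) :=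
  [/\ forall i k l, k <= r.+1 -> ball l v (P i k) <-> k <= l,
      forall i j k, 1 <= k <= r.+1 -> P i k = P j k -> i = j,
      forall i j k, k <= r ->
        adj (P i k) (P j k.+1) <-> (i = j \/ k = 0) &
      forall i, M (m i) /\ forall j, adj (P i r.+1) (m j) <-> (i == j) (+) eps].

(** Each branch vertex gets its own copy of the broom in [M], and each edge of the clique its own
    path index. The vertices [m i] are not copied: shared by all copies, they serve as middle
    vertices joining the two halves of a path. *)
Lemma no_broom r v P m eps :
  (forall u, M u -> ~ ball r.+1 v u) -> ~ broom r v P m eps.
Proof.
move=> far [lev inj path tr].
have Minj i j : m i = m j -> i = j.
  move=> mij; have [_ h] := tr i; apply/eqP.
  have : (i == i) (+) eps = (i == j) (+) eps.
    by apply/idP/idP => /h ?; apply/h; rewrite ?mij // -mij.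
  by move/addIb; rewrite eqxx => <-.
pose C := 'I_r.+3.
(* Colours are depths: only consecutive layers are joined, and the complementation [eps] is undone
   before the last layer. *)
pose g (c d : C) (b : bool) :=
  (c.+1 == d) && (if d == r.+2 :> nat then b (+) eps else b).
have [|n nP] := pfM (r := r.*2.+3) _ g; first by [].
pose vtx := subdiv_vertex r.*2.+3 n.
(* The extra index gives branch vertices a default, harmless because all paths start at [v]. *)
pose q := #|{: clique_edge n}|.
pose idx (x : vtx) : 'I_q.+1 :=
  if edge_of x is Some e then inord (enum_rank e) else ord0.
have idxE (x y : vtx) : edge_of x <> None -> edge_of y <> None ->
    idx x = idx y -> edge_of x = edge_of y.
  rewrite /idx; case: (edge_of x) => // e; case: (edge_of y) => // e' _ _.
  move=> /(congr1 val); rewrite /= !inordK; try exact: leqW (ltn_ord _).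
  by move/val_inj/enum_rank_inj ->.
have edgeN (x : vtx) : 0 < depth x -> edge_of x <> None by case: x => [|[]].
pose t (ik : 'I_q.+1 * 'I_r.+2) := P ik.1 ik.2.
have Mt ik : ~ M (t ik).
  move=> Mt; apply: (far _ Mt); apply/lev; exact: leq_ord.
pose B := [set m (i : 'I_q.+1) | i in [set: 'I_q.+1]].
have [||c [Mc eqc adjc cB cc]] := independent_copies (B := B) _ _ Mt.
- by apply: finite_image; exact: finite_finset.
- by move=> _ [i _ <-]; have [] := tr i.
have mB (i : 'I_q.+1) : B (m i) by exists i.
pose f (x : vtx) := if depth x == r.+2 then m (idx x)
  else c (side x) (idx x, inord (depth x)).
have dK (x : vtx) :
    depth x != r.+2 -> (inord (depth x) : 'I_r.+2) = depth x :> nat.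
  by move=> dx; rewrite inordK //; have := depth_le x; lia.
have ff (x : vtx) : depth x != r.+2 -> f x = c (side x) (idx x, inord (depth x)).
  by rewrite /f => /negbTE ->.
have fm (x : vtx) : depth x = r.+2 -> f x = m (idx x) by rewrite /f => ->; rewrite eqxx.
pose chi (x : vtx) : C := inord (depth x).
have chiE (x : vtx) : chi x = depth x :> nat by rewrite inordK // ltnS depth_le.
have idx_eq (x y : vtx) : (depth x).+1 = depth y ->
    (idx x == idx y :> nat) || (depth x == 0) <->
    (edge_of x = edge_of y \/ depth x = 0).
  move=> dxy; split=> [/orP[/eqP/val_inj e|/eqP]|[e|->]]; last by rewrite orbT.
  - case: (posnP (depth x)) => dx; first by right.
    by left; apply: idxE e; apply: edgeN; lia.
  - by right.
  - by rewrite /idx e eqxx.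
have tadj (x y : vtx) : depth y != r.+2 -> (depth x).+1 = depth y ->
    adj (t (idx x, inord (depth x))) (t (idx y, inord (depth y))) <->
    (edge_of x = edge_of y \/ depth x = 0).
  move=> yr dxy; have := depth_le y => yr2.
  rewrite /t /= !dK //; last lia.
  rewrite -idx_eq // -dxy path; last lia.
  by split=> [[/eqP ->//|/eqP ->]|/orP[/eqP|/eqP]]; rewrite ?orbT; auto.
have fadj (x y : vtx) : (depth x).+1 = depth y ->
    (if depth y == r.+2 then `[< adj (f x) (f y) >] (+) eps
     else `[< adj (f x) (f y) >]) <-> below x y.
  move=> dxy; have := depth_le y => yr2.
  have xr : depth x != r.+2 by lia.
  have -> : below x y <-> ((edge_of x = edge_of y \/ depth x = 0) /\
      (side x = side y \/ depth y = r.+2)).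
    by split=> [[]//|[]].
  have [dy|dy] := eqVneq (depth y) r.+2.
    rewrite -idx_eq // (ff x) // (fm y) //.
    have -> : `[< adj (c (side x) (idx x, inord (depth x))) (m (idx y)) >] =
        (idx x == idx y :> nat) (+) eps.
      have [_ adjE] := cB (side x) (idx x, inord (depth x)) _ (mB (idx y)).
      have [_ trE] := tr (idx x).
      apply/asboolP/idP; rewrite adjE /t /= dK //.
        by rewrite (_ : depth x = r.+1) ?trE //; lia.
      by rewrite (_ : depth x = r.+1) ?trE //; lia.
    have -> : (depth x == 0) = false by lia.
    by rewrite addbK orbF; split=> [?|[]//]; split=> //; right.
  rewrite (ff x) // (ff y) //; have [sxy|sxy] := eqVneq (side x) (side y).
    rewrite sxy -tadj // -(adjc (side y)); split=> [/asboolP ?|[? _]]; last exact/asboolP.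
    by split=> //; left.
  split=> [/asboolP|[_ [/eqP|/eqP]]]; rewrite ?(negbTE sxy) ?(negbTE dy) //.
  have ne : (side x : nat) <> side y by move/val_inj/eqP; rewrite (negbTE sxy).
  (* Between different copies no edge arises: [x] has depth at most [r], so its original lies in
     [ball r v] and has an empty trace. *)
  have [_ nadj] := cc _ _ (idx x, inord (depth x)) (idx y, inord (depth y)) ne.
  move=> cadj; exfalso; apply: nadj cadj => u Mu; apply: inner_trace far _ Mu.
  by rewrite /t /= dK //; apply/lev; lia.
apply: (nP chi f).
- move=> x; rewrite /f; case: ifP => _; last exact: Mc.
  by have [] := tr (idx x).
- move=> x y; have [dx|dx] := eqVneq (depth x) r.+2;
    have [dy|dy] := eqVneq (depth y) r.+2.
  + rewrite !fm // => /Minj/val_inj e; apply: coordinates_inj.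
    * by rewrite dx dy.
    * by right.
    * by left; apply: idxE e; apply: edgeN; lia.
  + rewrite fm // ff // => e.
    by have [/(_ (esym e))] := cB (side y) (idx y, inord (depth y)) _ (mB (idx x)).
  + rewrite ff // fm // => e.
    by have [/(_ e)] := cB (side x) (idx x, inord (depth x)) _ (mB (idx y)).
  + rewrite !ff //; have [sxy|sxy] := eqVneq (side x) (side y); last first.
      have ne : (side x : nat) <> side y.
        by move/val_inj/eqP; rewrite (negbTE sxy).
      by have [] := cc _ _ (idx x, inord (depth x)) (idx y, inord (depth y)) ne.
    have := depth_le x; have := depth_le y => yr xr.
    rewrite sxy eqc /t /= !dK // => eP.
    have dxy : depth x = depth y.
      apply/eqP; rewrite eqn_leq; apply/andP; split.
        by rewrite -(lev (idx x)) ?eP ?lev; lia.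
      by rewrite -(lev (idx y)) -?eP ?lev; lia.
    apply: coordinates_inj => //; first by left.
    case: (posnP (depth x)) => d0; first by right.
    left; apply: idxE; try by apply: edgeN; lia.
    by apply: val_inj; apply: (inj _ _ (depth x)); [lia|rewrite eP dxy].
- move=> x y; rewrite subdiv_adj_below /color_adj /g !chiE.
  have asC : `[< adj (f x) (f y) >] = `[< adj (f y) (f x) >].
    by apply: asbool_equiv_eq; exact: adjC.
  split=> [[_ [|]] /andP[/eqP d h]|[b|b]].
  + by left; apply/fadj.
  + by right; apply/fadj => //; rewrite -asC.
  + have [d _ _] := b; split; first by move=> e; move: d; rewrite e; lia.
    by left; rewrite d eqxx; exact/fadj.
  + have [d _ _] := b; split; first by move=> e; move: d; rewrite e; lia.
    by right; rewrite d eqxx asC; exact/fadj.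
Qed.

(** A common vertex on a layer, or an edge from an earlier path to the next layer of a later one,
    would bring the later endpoint within [r] of the earlier first vertex. Edges in the opposite
    direction are made homogeneous and excluded by stability. *)
Lemma broom_extraction r (v : N) (P : nat -> nat -> N) :
  (forall i, P i 0 = v) ->
  (forall i k, k <= r -> adj (P i k) (P i k.+1)) ->
  (forall i, ~ ball r v (P i r.+1)) ->
  (forall i j, i < j -> ~ ball r (P i 1) (P j r.+1)) ->
  (forall i j, i < j -> ~ same_trace M (P i r.+1) (P j r.+1)) ->
  exists P' m eps, broom r v P' m eps.
Proof.
move=> P0 Padj Pfar Pnew Ptr.
have Pball i k l : k <= l <= r.+1 -> ball (l - k) (P i k) (P i l).
  move=> /andP[kl lr]; rewrite -{2}(subnKC kl).
  by apply: ball_path => j jl; apply: Padj; lia.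
have lev i k l : k <= r.+1 -> ball l v (P i k) <-> k <= l.
  move=> kr; split=> [vl|kl]; last first.
    by apply: (ball_le kl); rewrite -(P0 i) -{1}(subn0 k); apply: Pball; lia.
  rewrite leqNgt; apply/negP => lk; apply: (Pfar i).
  have b : ball (r.+1 - k) (P i k) (P i r.+1) by apply: Pball; lia.
  by apply: ball_le (ball_trans vl b); lia.
have ne i j k : i < j -> 1 <= k <= r.+1 -> P i k <> P j k.
  move=> ij kr e; apply: (Pnew i j ij).
  have b1 : ball (k - 1) (P i 1) (P i k) by apply: Pball; lia.
  have b2 : ball (r.+1 - k) (P j k) (P j r.+1) by apply: Pball; lia.
  by rewrite e in b1; apply: ball_le (ball_trans b1 b2); lia.
have nadj i j k : i < j -> 1 <= k <= r -> ~ adj (P i k) (P j k.+1).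
  move=> ij kr /ball_adj b; apply: (Pnew i j ij).
  have b1 : ball (k - 1) (P i 1) (P i k) by apply: Pball; lia.
  have b2 : ball (r.+1 - k.+1) (P j k.+1) (P j r.+1) by apply: Pball; lia.
  by apply: ball_le (ball_trans b1 (ball_trans b b2)); lia.
pose w i := P i r.+1.
have [A uA|g [m [gI gm]]] := @thinning N
    (fun a m b => M m /\ (adj (w b) m <-> ~ adj (w a) m)).
  have [a0 _ Aa0] := uA 0; have [a1 a01 Aa1] := uA a0.
  have /existsNP[m /not_implyP[Mm nm]] := Ptr _ _ a01.
  have [a [Aa wa]] : exists a, A a /\ adj (w a) m.
    apply: contrapT => /forallNP H; apply: nm.
    by split=> h; [case: (H a0)|case: (H a1)].
  have [a' [Aa' wa']] : exists a, A a /\ ~ adj (w a) m.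
    apply: contrapT => /forallNP H; apply: nm.
    by split=> _; apply: contrapT => h; [case: (H a1)|case: (H a0)].
  (* [m] splits the endpoints: an unbounded part agrees on [m], and the committed index is taken
     from the opposite side. *)
  have [uB|uB] := unbounded_split [set b | adj (w b) m] uA.
  - exists a', m; eexists; split; [exact: Aa'| |exact: uB|].
      by move=> ? [].
    by move=> b [_ /= wb]; split=> //; tauto.
  - exists a, m; eexists; split; [exact: Aa| |exact: uB|].
      by move=> ? [].
    by move=> b [_ /= wb]; split=> //; tauto.
have [g2 g2I [c gc]] := pigeonhole (fun i => `[< adj (w (g i)) (m i) >]).
(* [Some k] controls edges from layer [k.+1] of a later path to layer [k.+2] of an earlier one;
   [None] controls endpoints against later [m]. *)
have [g3 g3I [b bP]] := @ramsey_family (option 'I_r)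
  (fun o i j => if o is Some k then adj (P (g (g2 j)) k.+1) (P (g (g2 i)) k.+2)
                else adj (w (g (g2 i))) (m (g2 j))).
pose h i := g2 (g3 i).
have hI : increasing h by exact: increasing_comp.
pose P' i := P (g (h i)); pose m' i := m (h i).
have lt i j : i < j -> g (h i) < g (h j) by move=> ij; apply/gI/hI.
have bk (k : 'I_r) : b (Some k) = false.
  apply/negP => bk; apply: stabN.
  exists (fun i => P' i k.+2), (fun j => P' j k.+1) => i j; rewrite adjC.
  case: (ltngtP i j) => [ij|ji|->]; split=> //.
  - by move=> _; exact/(bP (Some k)).
  - by move=> /(nadj _ _ k.+1 (lt _ _ ji))[]; have := ltn_ord k; lia.
  - by move=> _; apply: Padj; have := ltn_ord k; lia.
have wd i : adj (w (g (h i))) (m' i) <-> c.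
  by rewrite -(gc (g3 i)); split=> [/asboolP|/asboolP].
have wlo i j : i < j -> adj (w (g (h j))) (m' i) <-> ~~ c.
  move=> /hI /gm[_ ->]; rewrite wd; by split=> /negP.
have whi i j : i < j -> adj (w (g (h i))) (m' j) <-> b None by exact: (bP None).
(* Pairs on either side of the diagonal must behave alike, opposite to the diagonal; otherwise
   endpoints and [m] form a half graph, up to a shift when [c] is false. *)
have bN : b None = ~~ c.
  apply: contrapT => /eqP; rewrite negb_eqb addbN -negb_eqb negbK => /eqP bc.
  apply: stabN; move: bc wd wlo whi; case: c {gc} => -> wd wlo whi.
  - exists (fun i => w (g (h i))), m' => i j.
    case: (ltngtP i j) => [ij|ji|->]; [exact: whi|exact: wlo|exact: wd].
  - exists m', (fun j => w (g (h j.+1))) => i j; rewrite adjC -ltnS.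
    case: (ltngtP i j.+1) => [ij|ji|->]; [exact: wlo|exact: whi|exact: wd].
exists P', m', (~~ c); split.
- by move=> i; exact: lev.
- move=> i j k kr e; case: (ltngtP i j) => // ij.
  + by case: (ne _ _ k (lt _ _ ij) kr).
  + by case: (ne _ _ k (lt _ _ ij) kr); exact: esym.
- move=> i j k kr; case: (posnP k) => [->|k0].
    split=> [_|_]; first by right.
    by rewrite /P' P0 -(P0 (g (h j))); exact: Padj.
  case: (ltngtP i j) => [ij|ji|->].
  + split=> [|[|]]; [|lia|lia].
    by move/(nadj _ _ k (lt _ _ ij)) => []; lia.
  + split=> [|[|]]; [|lia|lia].
    have kr' : k.-1 < r by lia.
    have := (bP (Some (Ordinal kr')) _ _ ji).1.
    by rewrite bk /= -/(h i) -/(h j) prednK // => H /H.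
  + by split=> [_|_]; [left|exact: Padj].
- move=> i; split; first by have [] := gm _ _ (hI _ _ (ltnSn i)).
  move=> j; case: (ltngtP i j) => [ij|ji|<-].
  + by rewrite -/(w (g (h i))) whi // bN.
  + by rewrite -/(w (g (h i))) wlo.
  + by rewrite -/(w (g (h i))) wd addTb negbK.
Qed.

(** By induction the balls of radius [r] around neighbours of [v] have finitely many traces each.
    Infinitely many traces in [ball r.+1 v] thus always leave an endpoint whose trace is new to the
    balls around all neighbours used before, and geodesics to such endpoints yield a broom. *)
Lemma finite_traces r (v : N) : (forall u, M u -> ~ ball r v u) ->
  finitely_many_traces M (ball r v).
Proof.
elim: r v => [|r IH] v far.
  by exists [set v]; split; [exact: finite_set1|move=> _ ->; exists v].
apply: contrapT => inf.
have inner x : adj v x -> finitely_many_traces M (ball r x).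
  move=> vx; apply: IH => u Mu xu; apply: (far u Mu).
  by rewrite -add1n; exact: ball_trans (ball_adj vx) xu.
have /choice[R RP] x : exists R : set N, finite_set R /\ (adj v x ->
    forall w, ball r x w -> exists2 w', R w' & same_trace M w w').
  have [vx|nvx] := pselect (adj v x); last first.
    by exists set0; split=> //; exact: finite_set0.
  by have [R [fR RP]] := inner x vx; exists R.
pose G : set (N * N) := [set p |
  [/\ adj v p.1, ball r p.1 p.2 & exists2 m, M m & adj p.2 m]].
pose Q (A : set (N * N)) (p : N * N) := forall q w, A q -> ball r q.1 w ->
  ~ same_trace M p.2 w.
have [A fA AG|f fP] := @finite_history _ G Q.
  have [w [vw wP]] : exists w, ball r.+1 v w /\
      forall w', (\bigcup_(q in A) R q.1 `|` [set v]) w' -> ~ same_trace M w w'.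
    apply: contrapT => /forallNP H; apply: inf.
    (* Including [v] rules out the empty trace, so [w] lies outside [ball r v]. *)
    exists (\bigcup_(q in A) R q.1 `|` [set v]); split.
      rewrite finite_setU; split; last exact: finite_set1.
      by apply: bigcup_finite => // q _; have [] := RP q.1.
    move=> w vw; apply: contrapT => nw; apply: (H w); split=> // w' Rw' ww'.
    by apply: nw; exists w'.
  have [m Mm wm] : exists2 m, M m & adj w m.
    apply: contrapT => nm; apply: (wP v); first by right.
    move=> m Mm; split=> [wm|vm]; first by case: nm; exists m.
    by have := inner_trace far (ball_self r v) Mm vm.
  have [vw'|[x vx xw]] := ball_front vw.
    by have := inner_trace far vw' Mm wm.
  exists (x, w); first by split=> //; exists m.
  move=> q w'' Aq qw'' ww''; have [vq _ _] := AG q Aq.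
  have [_ /(_ vq w'' qw'')[w' Rw' w''w']] := RP q.1.
  apply: (wP w'); first by left; exists q.
  by move=> u Mu; rewrite ww'' // w''w'.
have notin i : ~ ball r v (f i).2.
  by have [[_ _ [m Mm wm]] _] := fP i => vw; exact: (inner_trace far vw Mm wm).
have /choice[p pP] i : exists p : nat -> N, [/\ p 0 = (f i).1, p r = (f i).2 &
    forall k, k < r -> adj (p k) (p k.+1)].
  have [[vx xw _] _] := fP i; apply: geodesic xw _ => s sr xs.
  apply: (notin i); apply: (@ball_le _ s.+1 r) => //; rewrite -add1n.
  exact: ball_trans (ball_adj vx) xs.
have [||||//|P' [m [eps]]] :=
    @broom_extraction r v (fun i k => if k is k'.+1 then p i k' else v).
- by [].
- move=> i [_|k kr]; have [p0 _ pS] := pP i; last exact: pS.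
  by rewrite p0; have [[]] := fP i.
- by move=> i; have [_ -> _] := pP i.
- move=> i j ij; have [-> _ _] := pP i; have [_ -> _] := pP j => b.
  have [_ /(_ (f i) (f j).2)] := fP j; apply=> //; exists i => //.
- move=> i j ij; have [_ -> _] := pP i; have [_ -> _] := pP j => ww.
  have [_ /(_ (f i) (f i).2)] := fP j; apply.
  + by exists i.
  + by have [[]] := fP i.
  + by move=> u Mu; rewrite ww.
exact: no_broom.
Qed.

End FiniteTraces.

(** * First-order logic *)

Definition conjunction (P : Type) n (T : Type) (F : T -> formula P n)
    (s : seq T) : formula P n :=
  foldr (fun x => FAnd (F x)) (FNot (FFalse P n)) s.

Definition disjunction (P : Type) n (T : Type) (F : T -> formula P n)
    (s : seq T) : formula P n :=
  foldr (fun x => FOr (F x)) (FFalse P n) s.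

Lemma holds_conjunction (P : Type) (G : graph) (I : expansion P G) n
    (T : finType) (F : T -> formula P n) e :
  holds I (conjunction F (enum T)) e <-> forall x, holds I (F x) e.
Proof.
suff H s : holds I (conjunction F s) e <-> forall x, x \in s -> holds I (F x) e.
  by rewrite H; split=> h x; [apply: h; rewrite mem_enum|].
elim: s => [|y s IH] /=; first by split=> // _; exact.
rewrite IH; split=> [[hy hs] x|h].
  by rewrite inE => /orP[/eqP->|/hs].
by split=> [|x xs]; apply: h; rewrite inE ?eqxx ?xs ?orbT.
Qed.

Lemma holds_disjunction (P : Type) (G : graph) (I : expansion P G) n
    (T : finType) (F : T -> formula P n) e :
  holds I (disjunction F (enum T)) e <-> exists x, holds I (F x) e.
Proof.
suff H s : holds I (disjunction F s) e <-> exists2 x, x \in s & holds I (F x) e.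
  by rewrite H; split=> [[x]|[x hx]]; exists x; rewrite ?mem_enum.
elim: s => [|y s IH] /=; first by split=> // -[].
rewrite IH; split=> [[hy|[x xs hx]]|[x]].
- by exists y; rewrite ?inE ?eqxx.
- by exists x; rewrite ?inE ?xs ?orbT.
- by rewrite inE => /orP[/eqP->|xs hx]; [left|right; exists x].
Qed.

Definition literal (P : Type) n (b : bool) (phi : formula P n) :=
  if b then phi else FNot phi.

Lemma holds_literal (P : Type) (G : graph) (I : expansion P G) n (Q : Prop)
    (phi : formula P n) e :
  holds I (literal `[< Q >] phi) e <-> (holds I phi e <-> Q).
Proof. by rewrite /literal; case: asboolP => /= h; tauto. Qed.

Definition diagram (P : Type) (N : graph) n (e : 'I_n -> N) : formula P n :=
  conjunction (fun ij : 'I_n * 'I_n =>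
    FAnd (literal `[< e ij.1 = e ij.2 >] (FEq P ij.1 ij.2))
         (literal `[< adj (e ij.1) (e ij.2) >] (FAdj P ij.1 ij.2)))
    (enum {: 'I_n * 'I_n}).

Lemma holds_diagram (P : Type) (N G : graph) (I : expansion P G) n
    (e : 'I_n -> N) (e' : 'I_n -> G) :
  holds I (diagram P e) e' <-> forall i j,
    (e' i = e' j <-> e i = e j) /\ (adj (e' i) (e' j) <-> adj (e i) (e j)).
Proof.
rewrite holds_conjunction; split=> [h i j|h [i j]] /=.
  by have /= := h (i, j); rewrite !holds_literal.
by rewrite !holds_literal; exact: h.
Qed.

(** Since [FEx] binds variable 0, the quantified variables come first and the parameters are the
    last [n]. *)
Fixpoint exists_prefix (P : Type) n k : formula P (k + n) -> formula P n :=
  match k return formula P (k + n) -> formula P n with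
  | 0 => id
  | k'.+1 => fun phi => @exists_prefix P n k' (FEx (n := k' + n) phi)
  end.

Lemma holds_exists_prefix (P : Type) (G : graph) (I : expansion P G) n k
    (phi : formula P (k + n)) e :
  holds I (exists_prefix phi) e <-> exists e' : 'I_(k + n) -> G,
    (forall i, e' (rshift k i) = e i) /\ holds I phi e'.
Proof.
elim: k phi => [|k IH] phi /=.
  have r0 i : rshift 0 i = i :> 'I_(0 + n) by exact: val_inj.
  split=> [h|[e' [ee' h]]]; first by exists e; split=> // i; rewrite r0.
  by suff -> : e = e' by []; apply: funext => i; rewrite -ee' r0.
rewrite IH; split=> [[e' [ee' [a h]]]|[e' [ee' h]]].
  exists (extend_val a e'); split=> // i; rewrite -ee' /extend_val.
  by rewrite (_ : rshift k.+1 i = lift ord0 (rshift k i)) ?liftK //; exact: val_inj.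
exists (fun i => e' (lift ord0 i)); split.
  by move=> i; rewrite -ee'; congr e'; exact: val_inj.
exists (e' ord0); suff <- : e' = extend_val (e' ord0) (fun i => e' (lift ord0 i)).
  by [].
by apply: funext => i; rewrite /extend_val; case: unliftP => [j|] ->.
Qed.

(** * Transfer along elementary extensions *)

Section ElementaryExtension.
Variables (M N : graph) (iota : M -> N).
Hypothesis elem : elementary_extension iota.

Lemma elementary_adj (u w : M) : adj (iota u) (iota w) <-> adj u w.
Proof.
have [_ /(_ 2 (FAdj void ord0 ord_max) (pair_val u w))] := elem.
by rewrite /= /pair_val /=; tauto.
Qed.

(** The diagram of the tuple and its parameters, with the tuple quantified existentially, holds in
    [N] and hence in [M]; a witness there is the copy. *)
Lemma elementary_existentially_closed : existentially_closed (range iota).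
Proof.
move=> I t A /finite_enum[n [s ->]] sM.
have /choice[m mP] i : exists m : M, iota m = s i.
  by have [|m _ <-] := sM (s i); [exists i|exists m].
pose e (i : 'I_(#|I| + n)) : N :=
  match fintype.split i with inl i => t (enum_val i) | inr j => s j end.
have el i : e (lshift n (enum_rank i)) = t i.
  by rewrite /e (unsplitK (inl _)) enum_rankK.
have er j : e (rshift #|I| j) = s j by rewrite /e (unsplitK (inr _)).
have : holds (@graph_expansion N) (exists_prefix (diagram void e)) (iota \o m).
  apply/holds_exists_prefix; exists e; split=> [i|]; first by rewrite er /= mP.
  exact/holds_diagram.
have [iinj h] := elem.
move=> /h /holds_exists_prefix[e' [e'm /holds_diagram d]].
exists (fun i => iota (e' (lshift n (enum_rank i)))); split.
- by move=> i; exists (e' (lshift n (enum_rank i))).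
- move=> i j; have [dij _] := d (lshift n (enum_rank i)) (lshift n (enum_rank j)).
  by rewrite -!el -dij; split=> [/iinj|->].
- move=> i j; have [_ dij] := d (lshift n (enum_rank i)) (lshift n (enum_rank j)).
  by rewrite elementary_adj -!el.
- move=> i _ [j _ <-]; have [dij _] := d (lshift n (enum_rank i)) (rshift _ j).
  by rewrite -el -er -dij er -mP e'm; split=> [/iinj|->].
- move=> i _ [j _ <-]; have [_ dij] := d (lshift n (enum_rank i)) (rshift _ j).
  by rewrite -el -er -dij er -mP e'm elementary_adj.
Qed.

Lemma elementary_no_half_graph : stable_edge_relation M -> no_half_graph N.
Proof.
move=> [l nl] [a [b ab]]; apply: nl.
have [t [Mt _ adjt _ _]] := elementary_existentially_closed
  (fun x : 'I_l + 'I_l => match x with inl i => a i | inr j => b j end)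
  (finite_set0 N) (@sub0set _ _).
have /choice[m mP] x : exists m : M, iota m = t x by have [m _] := Mt x; exists m.
exists (fun i => m (inl i)), (fun j => m (inr j)) => i j.
by rewrite -elementary_adj !mP adjt ab.
Qed.

Definition color_formula (C : finType) (g : C -> C -> bool -> bool) :
    formula C 2 :=
  disjunction (fun cd : C * C =>
    FAnd (FPred cd.1 ord0) (FAnd (FPred cd.2 ord_max)
      (FOr (FAnd (literal (g cd.1 cd.2 true) (FNot (FFalse C 2)))
                 (FAdj C ord0 ord_max))
           (FAnd (literal (g cd.1 cd.2 false) (FNot (FFalse C 2)))
                 (FNot (FAdj C ord0 ord_max))))))
    (enum {: C * C}).

Lemma color_formula_qf (C : finType) (g : C -> C -> bool -> bool) :
  quantifier_free (color_formula g).
Proof.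
rewrite /color_formula; elim: (enum _) => //= cd s ->.
by rewrite /literal; case: (g _ _ true); case: (g _ _ false).
Qed.

Lemma holds_color_formula (G : graph) (C : finType)
    (g : C -> C -> bool -> bool) (I : expansion C G) (u w : G) :
  holds I (color_formula g) (pair_val u w) <->
  exists c d, [/\ I c u, I d w & g c d `[< adj u w >]].
Proof.
rewrite holds_disjunction.
have lit b : holds I (literal b (FNot (FFalse C 2))) (pair_val u w) <-> b.
  by case: b => /=; split=> //; [move=> _ []|move=> []].
split=> [[[c d] /= [Ic [Id h]]]|[c [d [Ic Id h]]]].
  exists c, d; split=> //; move: h; rewrite !lit.
  by case: asboolP => auw [[]|[]].
exists (c, d) => /=; do 2![split=> //]; rewrite !lit.
by move: h; case: asboolP => auw h; [left|right].
Qed.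

Lemma elementary_pattern_free_on :
  pattern_free M -> pattern_free_on (range iota).
Proof.
move=> pfM r r1 C g; have [iinj _] := elem.
have [n nP] := pfM r r1 C setT (color_formula g) (color_formula_qf g).
exists n => chi f Mf injf H.
have /choice[f' f'P] x : exists m : M, iota m = f x by have [m _] := Mf x; exists m.
have f'inj : injective f' by move=> x y e; apply: injf; rewrite -!f'P e.
(* Only vertices of the pattern are coloured; injectivity gives each a single colour. *)
pose I : expansion C M := fun c u => exists2 x, f' x = u & chi x = c.
have IE x y : holds I (color_formula g) (pair_val (f' x) (f' y)) <->
    g (chi x) (chi y) `[< adj (f x) (f y) >].
  rewrite holds_color_formula.
  have -> : `[< adj (f' x) (f' y) >] = `[< adj (f x) (f y) >].
    by apply: asbool_equiv_eq; rewrite -elementary_adj !f'P.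
  split=> [[c [d [[x' /f'inj-> <-] [y' /f'inj-> <-]]]]//|h].
  by exists (chi x), (chi y); split=> //; [exists x|exists y].
apply: (nP I) => //; exists f'; split=> // x y; apply: iff_trans (H x y).
rewrite /= /interp_adj !IE /color_adj.
have -> : `[< adj (f y) (f x) >] = `[< adj (f x) (f y) >].
  by apply: asbool_equiv_eq; exact: adjC.
by split=> -[ne h]; split=> // e; apply: ne; [rewrite e|exact: f'inj].
Qed.

End ElementaryExtension.

(** * Iterating the separation step *)

(** [X'] respects classes of the flipped graph, but the conclusion concerns those of [N]. Vertices
    in one class over the union are treated alike by [X], so they keep equal neighbourhoods in [S']
    after the first flip. *)
Lemma respects_classes_comp (N : graph) (S S' : set N) (X X' : N -> N -> Prop)
    (symX : symmetric_rel X) :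
  respects_classes S X -> @respects_classes (rel_flip symX) S' X' ->
  respects_classes (S `|` S')
    (fun u w => X u w /\ ~ X' u w \/ ~ X u w /\ X' u w).
Proof.
move=> rX rX' u u' w uu'.
have cS : same_class S u u' by apply: same_class_sub uu' => ?; left.
have cS' : @same_class (rel_flip symX) S' u u'.
  case: uu' => [->|[Su Su' adjE]]; first by left.
  right; split=> [Sx|Sx|s Ss]; [by apply: Su; right|by apply: Su'; right|].
  have XE := respects_classes2 symX rX cS (or_introl (erefl s)).
  have [us u's] : u <> s /\ u' <> s.
    by split=> e; [apply: Su|apply: Su']; right; rewrite e.
  have aE : adj u s <-> adj u' s by apply: adjE; right.
  by rewrite /= /rel_flip_adj; tauto.
have XE : X u w <-> X u' w.
  by split; apply: rX => //; exact: same_class_sym.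
have X'E : X' u w <-> X' u' w.
  by split; apply: rX' => //; exact: same_class_sym.
tauto.
Qed.

Lemma separating_flip (N : graph) (M : set N) :
  no_half_graph N -> existentially_closed M -> pattern_free_on M ->
  forall (v : N) r, ~ M v ->
  exists (S : set N) (X : N -> N -> Prop) (symX : symmetric_rel X),
    [/\ finite_set S, S `<=` M, respects_classes S X &
        forall u, M u -> ~ @ball (rel_flip symX) r v u].
Proof.
move=> stabN ecM pfM v r Mv; elim: r => [|r [S [X [symX [fS SM rX far]]]]].
  have sym0 : symmetric_rel (fun _ _ : N => False) by [].
  exists set0, _, sym0; split=> //.
  by move=> u Mu uv; apply: Mv; rewrite -uv.
have stab' := rel_flip_no_half_graph (symX := symX) rX fS stabN.
have ec' := rel_flip_existentially_closed (symX := symX) rX fS SM ecM.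
have pf' := rel_flip_pattern_free_on symX rX fS pfM.
have [S' [X' [symX' [fS' SM' rX' far']]]] :=
  separation_step stab' ec' far (finite_traces stab' ec' pf' far).
have symX'' :
    symmetric_rel (fun u w => X u w /\ ~ X' u w \/ ~ X u w /\ X' u w).
  move=> u w; have XE : X u w <-> X w u by split; exact: symX.
  have X'E : X' u w <-> X' w u by split; exact: symX'.
  tauto.
exists (S `|` S'), _, symX''; split.
- by rewrite finite_setU.
- by move=> x [/SM|/SM'].
- exact: respects_classes_comp rX rX'.
- move=> u Mu b; apply: (far' u Mu).
  (* Flipping by [X] and then by [X'] is flipping by their symmetric difference; the identity map is
     a homomorphism between the two presentations. *)
  pose id' (x : rel_flip symX'') : rel_flip symX' := x.
  apply: (ball_homo (phi := id') _ b) => x y [ne h]; split=> //.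
  have -> : @adj (rel_flip symX) (id' x) (id' y) <->
      (@adj N x y /\ ~ X x y \/ ~ @adj N x y /\ X x y) by split=> [[]|].
  move: h; rewrite /id'.
  by case: (pselect (X x y)); case: (pselect (X' x y)); tauto.
Qed.

Theorem mainTheorem5 (M : graph) :
  pattern_free M -> stable_edge_relation M -> forall r : nat, separable r M.
Proof.
move=> pfM stabM r N iota elem v Mv.
have [S [X [symX [fS SM rX far]]]] := separating_flip
  (elementary_no_half_graph elem stabM) (elementary_existentially_closed elem)
  (elementary_pattern_free_on elem pfM) r Mv.
(* Because [X] respects classes, a pair of classes containing one related pair consists entirely of
   related pairs. *)
pose F : set (set N * set N) :=
  [set p | exists u w, p = (class_of S u, class_of S w) /\ X u w].
have XF u w : F (class_of S u, class_of S w) -> X u w.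
  move=> [u' [w' [[cu cw] Xuw]]].
  have uu' : class_of S u u' by rewrite cu; left.
  have ww' : class_of S w w' by rewrite cw; left.
  by rewrite (respects_classes2 symX rX uu' ww').
exists S, F; split=> // u; apply/dist_gtP => k kr /ball_walk b.
apply: (far (iota u)); first by exists u.
pose id' (x : flip S F) : rel_flip symX := x.
apply: (ball_le kr); apply: (ball_homo (phi := id') _ b) => x y.
have fE : flipped S F x y <-> X x y.
  split=> [[/XF//|/XF/symX//]|Xxy]; by left; exists x, y.
by rewrite /= /flip_adj /rel_flip_adj fE.
Qed.
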